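(* The total domination number of the fractal cubic network $FCN(1)$ is $\gamma_t(FCN(1)) = 8$.
   Context: Fractal cubic network: for an integer $l\ge 0$, $FCN(l)$ is the finite simple graph whose vertices are all binary strings of length $2l+2$, defined recursively as follows. $FCN(0)$ is the 4-cycle with vertices $00, 01, 11, 10$ in this cyclic order. For $l\ge 1$, $FCN(l)$ is obtained from the disjoint union of the four copies $ab\,\Vert\,FCN(l-1)$, $a,b\in\{0,1\}$ (each vertex string of $FCN(l-1)$ is prefixed by $ab$, adjacency inside a copy being that of $FCN(l-1)$), by adding the four edges $\{00w,10w\}$, $\{10w,11w\}$, $\{11w,01w\}$, $\{01w,00w\}$, where $w=10(01)^{l-1}$ is the string $10$ followed by $l-1$ repetitions of $01$. A total dominating set of a graph $\Gamma$ is a set $D\subseteq V(\Gamma)$ such that every vertex of $\Gamma$ (including those in $D$) is adjacent to some vertex of $D$; $\gamma_t(\Gamma)$ is the minimum size of a total dominating set. *)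

(* Defs.v *)
From mathcomp Require Import all_boot.

Set Implicit Arguments.
Unset Strict Implicit.
Unset Printing Implicit Defensive.

Record sgraph := SGraph {
  vertex :> finType;
  adj : rel vertex;
  adj_sym : symmetric adj;
  adj_irr : irreflexive adj }.

(* Open neighbourhoods: a vertex of D also needs a neighbour in D. *)
Definition total_dominating (G : sgraph) (D : {set G}) : bool :=
  [forall x : G, exists y in D, adj x y].

(* If G has an isolated vertex then no total dominating set exists, and the
   value is the default #|G|; otherwise [set: G] is total dominating. *)
Definition total_domination_number (G : sgraph) : nat :=
  #|[arg min_(D < [set: G] | total_dominating D) #|D|]|.

(* Binary strings are sequences of booleans, with 0 = false and 1 = true. *)
Definition s00 : seq bool := [:: false; false].
Definition s01 : seq bool := [:: false; true].
Definition s10 : seq bool := [:: true; false].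
Definition s11 : seq bool := [:: true; true].

(* The cycle 00 - 01 - 11 - 10 - 00. Read backwards, this is also the cycle
   00 - 10 - 11 - 01 - 00 along which the four copies are joined. *)
Definition square_edges : seq (seq bool * seq bool) :=
  [:: (s00, s01); (s01, s11); (s11, s10); (s10, s00)].

Definition square_adj (u v : seq bool) : bool :=
  ((u, v) \in square_edges) || ((v, u) \in square_edges).

(* 10(01)^k; the string w used to build level l is [junction l.-1]. *)
Definition junction (k : nat) : seq bool := s10 ++ flatten (nseq k s01).

Fixpoint fcn_adj (l : nat) (u v : seq bool) : bool :=
  if l is k.+1 then
       (take 2 u == take 2 v) && fcn_adj k (drop 2 u) (drop 2 v)
    || [&& square_adj (take 2 u) (take 2 v),
           drop 2 u == junction k & drop 2 v == junction k]
  else square_adj u v.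

Lemma square_adj_sym : symmetric square_adj.
Proof. by move=> u v; rewrite /square_adj orbC. Qed.

Lemma square_adj_irr : irreflexive square_adj.
Proof.
move=> u; rewrite /square_adj orbb !inE !xpair_eqE.
by case: u => [|[] [|[] [|? ?]]].
Qed.

Lemma fcn_adj_sym l : symmetric (fcn_adj l).
Proof.
elim: l => [|l IHl] u v /=; first exact: square_adj_sym.
by rewrite eq_sym IHl square_adj_sym [(drop 2 u == _) && _]andbC.
Qed.

Lemma fcn_adj_irr l : irreflexive (fcn_adj l).
Proof.
elim: l => [|l IHl] u /=; first exact: square_adj_irr.
by rewrite IHl square_adj_irr andbF.
Qed.

Definition FCN (l : nat) : sgraph :=
  @SGraph ((2 * l + 2).-tuple bool) (fun u v => fcn_adj l u v)
    (fun u v => fcn_adj_sym l u v) (fun u => fcn_adj_irr l u).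

(* Main.v *)
Require Import Defs.
From mathcomp Require Import all_boot.

(** In each copy [ab||FCN(0)] the vertices [ab00] and [ab01] are not junctions,
    so their open neighbourhoods are [{ab01, ab10}] and [{ab00, ab11}]. These
    eight pairs are disjoint and each must meet a total dominating set. The
    eight vertices [abc0] attain the bound. *)

Lemma total_domination_number_eq (G : sgraph) (D : {set G}) :
  total_dominating D ->
  (forall E : {set G}, total_dominating E -> #|D| <= #|E|) ->
  total_domination_number G = #|D|.
Proof.
move=> domD minD; rewrite /total_domination_number; case: arg_minnP.
  (* [arg_minnP] needs the default [[set: G]] to be total dominating; this holds because [domD]
     already gives each vertex a neighbour. *)
  apply/forallP=> x; have /existsP[y /andP[_ xy]] := forallP domD x.
  by apply/existsP; exists y; rewrite inE.
by move=> E domE minE; apply/eqP; rewrite eqn_leq minE // minD.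
Qed.

(** Choosing in [D] a neighbour of each [p i] is injective, since no vertex is adjacent to two of
    them. *)
Lemma leq_card_total_dominating (G : sgraph) (I : finType) (p : I -> G)
    (D : {set G}) :
  (forall i j y, adj (p i) y -> adj (p j) y -> i = j) ->
  total_dominating D -> #|I| <= #|D|.
Proof.
move=> disj_p /forallP domD.
have sel i : {y | (y \in D) && adj (p i) y}.
  exact: sigW (existsP (domD (p i))).
have selD i : sval (sel i) \in D by case/andP: (svalP (sel i)).
have sel_adj i : adj (p i) (sval (sel i)) by case/andP: (svalP (sel i)).
have sel_inj : injective (fun i => sval (sel i)).
  move=> i j eq_ij; apply: (disj_p i j _ (sel_adj i)).
  by rewrite eq_ij; apply: sel_adj.
rewrite -(card_imset _ sel_inj); apply/subset_leq_card/subsetP.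
by move=> _ /imsetP[i _ ->].
Qed.

Definition fcn1_vertex (a b c d : bool) : FCN 1 := [tuple a; b; c; d].

Lemma fcn1_vertexP (x : FCN 1) : exists a b c d, x = fcn1_vertex a b c d.
Proof.
case: x => -[|a [|b [|c [|d [|? ?]]]]] // sz_x.
by exists a, b, c, d; apply: val_inj.
Qed.

Lemma fcn1_private_neighbours (i j : bool * bool * bool) (y : FCN 1) :
  adj (fcn1_vertex i.1.1 i.1.2 false i.2) y ->
  adj (fcn1_vertex j.1.1 j.1.2 false j.2) y -> i = j.
Proof.
case: (fcn1_vertexP y) => a [b [c [d ->]]].
by case: i => [[[] []] []]; case: j => [[[] []] []];
   case: a; case: b; case: c; case: d.
Qed.

Definition fcn1_dominators : {set FCN 1} :=
  [set fcn1_vertex i.1.1 i.1.2 i.2 false | i : bool * bool * bool].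

Lemma fcn1_dominators_total : total_dominating fcn1_dominators.
Proof.
apply/forallP=> x; case: (fcn1_vertexP x) => a [b [c [d ->]]].
(* The witness is the neighbour inside the copy [ab] with last bit 0: flip [d] if [d] is 1,
   otherwise flip [c]. Either way the third bit becomes [c == d]. *)
apply/existsP; exists (fcn1_vertex a b (c == d) false); apply/andP; split.
  by apply/imsetP; exists (a, b, c == d).
by case: a; case: b; case: c; case: d.
Qed.

Lemma card_fcn1_dominators : #|fcn1_dominators| = #|{: bool * bool * bool}|.
Proof. by apply: card_imset => -[[a b] c] [[a' b'] c'] [-> -> ->]. Qed.

Theorem theorem21 : total_domination_number (FCN 1) = 8.
Proof.
rewrite (total_domination_number_eq _ _ fcn1_dominators_total).
  by rewrite card_fcn1_dominators !card_prod card_bool.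
move=> E domE; rewrite card_fcn1_dominators.
exact: leq_card_total_dominating fcn1_private_neighbours domE.
Qed.
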